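(* The escape rate game has a uniform value $\rho$, and for every $\bar x\in X$ it is given by \[ \rho=\lim_{k\to\infty}\frac{[S^k d(\cdot,\bar x)](\bar x)}{k}=\max\{\lambda\in\mathbb{R}\mid \exists\, v\in \mathrm{Lip}_1,\ \lambda+v\leq Sv\}=\max_{v\in \mathrm{Lip}_1}\ \inf_{x\in X}\big(Sv(x)-v(x)\big). \] In particular both maxima are attained.
   Context: A hemi-metric on a nonempty set $X$ is a map $d:X\times X\to\mathbb{R}$ (possibly negative, not necessarily symmetric) such that $d(x,z)\leq d(x,y)+d(y,z)$ for all $x,y,z$, and $d(x,y)=d(y,x)=0$ if and only if $x=y$. The space $X$ carries the topology of the metric $d^\circ(x,y)=\max(d(x,y),d(y,x))$. A self-map $T$ of $X$ is nonexpansive if $d(T(x),T(y))\leq d(x,y)$ for all $x,y$. Setting: $(X,d)$ is a hemi-metric space, $\mathcal{A},\mathcal{B}$ are nonempty compact sets (action spaces), and for each $(a,b)\in\mathcal{A}\times\mathcal{B}$, $T_{ab}:X\to X$ is nonexpansive. Standing assumption: for all $x\in X$ the maps $b\mapsto T_{ab}(x)$ (each $a$) and $a\mapsto T_{ab}(x)$ (each $b$) are continuous, and for every compact $K\subset X$ the set $\{T_{ab}(x)\mid (a,b,x)\in\mathcal{A}\times\mathcal{B}\times K\}$ is compact. $\mathrm{Lip}_1$ is the set of functions $v:X\to\mathbb{R}$ with $v(x)-v(y)\leq d(x,y)$ for all $x,y\in X$. The Shapley operator $S:\mathrm{Lip}_1\to\mathrm{Lip}_1$ is $Sv(x)=\inf_{a\in\mathcal{A}}\sup_{b\in\mathcal{B}}v(T_{ab}(x))$.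 Inequalities between functions are pointwise, and $\lambda+v$ denotes $x\mapsto\lambda+v(x)$. Escape rate game: from an initial state $x_0\in X$, at each turn $k\geq1$ player Min chooses $a_k\in\mathcal{A}$, then player Max, having observed $a_k$, chooses $b_k\in\mathcal{B}$, and $x_k=T_{a_kb_k}(x_{k-1})$. A strategy $\sigma$ of Min maps each finite history $(x_0,a_1,b_1,x_1,\dots,a_k,b_k,x_k)$ to an element of $\mathcal{A}$; a strategy $\tau$ of Max maps each such history together with Min's next action to an element of $\mathcal{B}$. Let $J_k(\sigma,\tau)=d(x_k,x_0)$ for the play generated by $(\sigma,\tau)$. Min minimizes and Max maximizes the escape rate $J_\infty(\sigma,\tau)=\limsup_{k\to\infty}J_k(\sigma,\tau)/k$. The game has uniform value $v_\infty\in\mathbb{R}$ if for all $\epsilon>0$ there exist strategies $\sigma_\epsilon,\tau_\epsilon$ (of Min and Max) and $N$ such that for all $k\geq N$ and all strategies $\sigma$ of Min and $\tau$ of Max, $J_k(\sigma_\epsilon,\tau)/k\leq v_\infty+\epsilon$ and $J_k(\sigma,\tau_\epsilon)/k\geq v_\infty-\epsilon$. *)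

(* Defs.v *)
From HB Require Import structures.
From mathcomp Require Import all_boot all_order all_algebra.
From mathcomp Require Import all_classical all_reals all_analysis.

Set Implicit Arguments.
Unset Strict Implicit.
Unset Printing Implicit Defensive.

Import Order.TTheory GRing.Theory Num.Theory.
Import numFieldNormedType.Exports.

Local Open Scope classical_set_scope.
Local Open Scope ring_scope.

Definition is_maximum (disp : Order.disp_t) (V : porderType disp)
    (E : set V) (m : V) : Prop :=
  E m /\ ubound E m.

Definition hemi_metric (R : realType) (X : Type) (d : X -> X -> R) : Prop :=
  (forall x y z, d x z <= d x y + d y z) /\
  (forall x y, (d x y = 0 /\ d y x = 0) <-> x = y).

Definition nonexpansive (R : realType) (X : Type) (d : X -> X -> R)
    (f : X -> X) : Prop :=
  forall x y, d (f x) (f y) <= d x y.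

Definition Lip1 (R : realType) (X : Type) (d : X -> X -> R) : set (X -> R) :=
  [set v | forall x y, v x - v y <= d x y].

(* [inf] and [sup] are the real-valued ones, which default to 0 on empty or
   unbounded sets.  Under [escape_rate_game] below and for [v] in [Lip1 d],
   every set they are applied to is nonempty and bounded, and [shapley T]
   maps [Lip1 d] to itself. *)
Definition shapley (R : realType) (X A B : Type) (T : A -> B -> X -> X)
    (v : X -> R) : X -> R :=
  fun x => inf [set sup [set v (T a b x) | b in [set: B]] | a in [set: A]].

(* The topology of [X] is tied to [d] by requiring the metric of [X] to be
   the symmetrization max(d(x,y), d(y,x)). *)
Record escape_rate_game (R : realType) (X : metricType R)
    (A B : topologicalType) (d : X -> X -> R) (T : A -> B -> X -> X)
    : Prop := EscapeRateGame {
  erg_state_nonempty : [set: X] !=set0;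
  erg_hemi_metric : hemi_metric d;
  erg_mdist : forall x y : X, mdist x y = Num.max (d x y) (d y x);
  erg_min_nonempty : [set: A] !=set0;
  erg_min_compact : compact [set: A];
  erg_max_nonempty : [set: B] !=set0;
  erg_max_compact : compact [set: B];
  erg_nonexpansive : forall a b, nonexpansive d (T a b);
  erg_continuous_max : forall x a, continuous (fun b => T a b x);
  erg_continuous_min : forall x b, continuous (fun a => T a b x);
  erg_image_compact : forall K : set X, compact K ->
    compact [set y | exists a b x, K x /\ y = T a b x]
}.

(* (x0, [:: (a1, b1, x1); ...; (ak, bk, xk)]), in chronological order *)
Definition history (X A B : Type) : Type := (X * seq (A * B * X))%type.

Definition last_state (X A B : Type) (h : history X A B) : X :=
  last h.1 [seq s.2 | s <- h.2].

Definition min_strategy (X A B : Type) : Type := history X A B -> A.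

Definition max_strategy (X A B : Type) : Type := history X A B -> A -> B.

Fixpoint play (X A B : Type) (T : A -> B -> X -> X)
    (sigma : min_strategy X A B) (tau : max_strategy X A B)
    (x0 : X) (k : nat) : history X A B :=
  if k is k'.+1 then
    let h := play T sigma tau x0 k' in
    let a := sigma h in
    let b := tau h a in
    (h.1, rcons h.2 (a, b, T a b (last_state h)))
  else (x0, [::]).

Definition payoff (R : realType) (X A B : Type) (d : X -> X -> R)
    (T : A -> B -> X -> X) (x0 : X)
    (sigma : min_strategy X A B) (tau : max_strategy X A B) (k : nat) : R :=
  d (last_state (play T sigma tau x0 k)) x0.

Definition has_uniform_value (R : realType) (X A B : Type) (d : X -> X -> R)
    (T : A -> B -> X -> X) (x0 : X) (v : R) : Prop :=
  forall eps : R, 0 < eps ->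
  exists (sigma_eps : min_strategy X A B) (tau_eps : max_strategy X A B)
    (N : nat),
  forall k : nat, (N <= k)%N ->
  forall (sigma : min_strategy X A B) (tau : max_strategy X A B),
    payoff d T x0 sigma_eps tau k / k%:R <= v + eps /\
    payoff d T x0 sigma tau_eps k / k%:R >= v - eps.

(* Main.v *)
(* Write v0 = d(., z) and s_k = S^k v0 (z).  Since S is monotone, commutes with
   constants and preserves Lip1, S^n v0 <= s_n + v0, so s is subadditive and
   rho = lim s_k / k = inf s_k / k exists by Fekete's lemma.  If l + v <= S v
   with v in Lip1, then k l + v <= S^k v <= v(z) + S^k v0, hence l <= rho.  For
   the existence of such a v with l = rho, take l_n increasing to rho and
   iterate u |-> max(v0, S u - l_n) from v0: the iterates f increase, so they
   satisfy l_n + f <= S f wherever f > v0, and f(z) can be made larger than n.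
   Normalized at z, these f have a pointwise limit along an ultrafilter, which
   is the required v.
   Max guarantees rho by keeping v(x_k) - k rho almost nondecreasing, and Min
   by playing almost optimally over blocks of length p with s_p / p near rho. *)
Require Import Defs.
From HB Require Import structures.
From mathcomp Require Import all_boot all_order all_algebra.
From mathcomp Require Import all_classical all_reals all_analysis.
From mathcomp Require Import lra.

Set Implicit Arguments.
Unset Strict Implicit.
Unset Printing Implicit Defensive.

Import Order.TTheory GRing.Theory Num.Theory.
Import numFieldNormedType.Exports.

Local Open Scope classical_set_scope.
Local Open Scope ring_scope.

(** * Subadditive real sequences *)

(** With [k = q * p + r] and [r < p], the left side is at most [k * l - r * l + K], and
    [p * |l| + K] is absorbed by [k * e] for large [k]. *)
Lemma divn_growth_le (R : realType) (p : nat) (c l K e : R) :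
  (0 < p)%N -> c <= p%:R * l -> 0 < e ->
  exists N : nat, forall k, (N <= k)%N ->
    (k %/ p)%:R * c + K <= k%:R * (l + e).
Proof.
move=> p0 cpl e0.
have [N _ HN] := nbhs_infty_ger ((K + p%:R * `|l|) / e).
exists N => k /HN /=; rewrite ler_pdivrMr// => Kk.
have H1 : (k %/ p)%:R * c <= (k %/ p)%:R * (p%:R * l) by rewrite ler_wpM2l.
have H2 : (k %/ p)%:R * p%:R = k%:R - (k %% p)%:R :> R.
  by rewrite {2}(divn_eq k p) natrD natrM addrK.
rewrite mulrA H2 mulrBl in H1.
have H3 : - ((k %% p)%:R * l) <= p%:R * `|l|.
  rewrite -mulrN (le_trans (ler_norm _))// normrM normrN normr_nat.
  by rewrite ler_wpM2r// ler_nat ltnW// ltn_pmod.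
lra.
Qed.

Lemma fekete (R : realType) (s : nat -> R) (M : R) :
  (forall m n, s (m + n)%N <= s m + s n) ->
  (forall k, - (k%:R * M) <= s k) ->
  exists rho : R, (s k / k%:R @[k --> \oo] --> rho) /\
    forall k, k%:R * rho <= s k.
Proof.
move=> subs lbs; pose E := [set s k.+1 / k.+1%:R | k in [set: nat]].
have E0 : E !=set0 by exists (s 1%N / 1%:R), 0%N.
have lbE : has_lbound E.
  exists (- M) => _ [k _ <-]; rewrite ler_pdivlMr// mulNr mulrC.
  exact: lbs.
have rhoE k : k%:R * inf E <= s k.
  (* At [k = 0], subadditivity gives [0 <= s 0]. *)
  case: k => [|k]; first by rewrite mul0r; have := subs 0%N 0%N; lra.
  by rewrite mulrC -ler_pdivlMr//; apply: ge_inf => //; exists k.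
exists (inf E); split=> //; apply/cvgrPdist_le => e e0.
have [_ [p _ <-]] : exists2 x, E x & x < inf E + e / 2.
  by apply: inf_adherent => //; rewrite divr_gt0.
rewrite ltr_pdivrMr// mulrC => /ltW sp.
have sM j r : s (j * p.+1 + r)%N <= j%:R * s p.+1 + s r.
  elim: j => [|j IH]; first by rewrite mul0r add0r.
  rewrite mulSn -addnA (le_trans (subs _ _))//.
  by rewrite mulrS mulrDl mul1r -addrA lerD2l.
pose K : R := \sum_(i < p.+1) `|s i|.
have e2 : 0 < e / 2 by rewrite divr_gt0.
have [N HN] := divn_growth_le K (ltn0Sn p) sp e2.
exists N.+1 => // -[//|k] /ltnW /= /HN; rewrite -addrA -splitr => kN.
have sK : s (k.+1 %% p.+1)%N <= K.
  have rp : (k.+1 %% p.+1 < p.+1)%N by rewrite ltn_pmod.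
  rewrite /K (bigD1 (Ordinal rp))//= (le_trans (ler_norm _))// lerDl.
  exact: sumr_ge0.
have := sM (k.+1 %/ p.+1)%N (k.+1 %% p.+1)%N; rewrite -divn_eq => sk.
have sk1 : s k.+1 / k.+1%:R <= inf E + e.
  rewrite ler_pdivrMr// [_ * _%:R]mulrC; apply: le_trans (le_trans sk _) kN.
  by rewrite lerD2l.
have sk2 : inf E <= s k.+1 / k.+1%:R by rewrite ler_pdivlMr// mulrC.
rewrite ler_norml lerNl opprB lerBlDl sk1/= lerBlDl.
by rewrite (le_trans sk2)// lerDl ltW.
Qed.

Section EscapeRateGame.
Context {R : realType} {X : metricType R} {A B : topologicalType}
  {d : X -> X -> R} {T : A -> B -> X -> X} (G : escape_rate_game d T).

Local Notation S := (shapley T).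

(** * Lipschitz functions and compactness of the one-step successors *)

Let dtri x y z : d x z <= d x y + d y z.
Proof. by have [+ _] := erg_hemi_metric G; exact. Qed.

Let dxx x : d x x = 0.
Proof. by have [_ /(_ x x)[_ /(_ erefl)[]]] := erg_hemi_metric G. Qed.

Let d_mdist x y : d x y <= mdist x y.
Proof. by rewrite (erg_mdist G) le_max lexx. Qed.

Lemma Lip1_dist_to z : Lip1 d (d^~ z).
Proof. by move=> x y; rewrite lerBlDr. Qed.

Lemma Lip1_opp_dist_from z : Lip1 d (fun x => - d z x).
Proof. by move=> x y; have := dtri z x y; lra. Qed.

Lemma Lip1_addr v c : Lip1 d v -> Lip1 d (fun x => v x + c).
Proof. by move=> Lv x y; have := Lv x y; lra. Qed.

Lemma Lip1_max u v : Lip1 d u -> Lip1 d v ->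
  Lip1 d (fun x => Num.max (u x) (v x)).
Proof.
move=> Lu Lv x y; rewrite lerBlDr ge_max; apply/andP; split.
  by have := Lu x y; have : u y <= Num.max (u y) (v y);
    [rewrite le_max lexx|lra].
by have := Lv x y; have : v y <= Num.max (u y) (v y);
  [rewrite le_max lexx orbT|lra].
Qed.

Lemma Lip1_mdist v x y : Lip1 d v -> `|v x - v y| <= mdist x y.
Proof.
move=> Lv; rewrite ler_norml (le_trans (Lv x y))// andbT lerNl opprB.
by rewrite metric_sym (le_trans (Lv y x)).
Qed.

Lemma compact_successors x :
  compact [set T a b x | a in [set: A] & b in [set: B]].
Proof.
have := erg_image_compact G (@compact_set1 X x).
congr (compact _); apply/seteqP; split=> y.
  by move=> [a [b [_ [-> ->]]]]; exists a => //; exists b.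
by move=> [a _ [b _ <-]]; exists a, b, x.
Qed.

(** On the unit ball around a successor [y], [|v|] is at most [|v y| + 1]; compactness makes the
    bound uniform. It keeps every [inf] and [sup] in [S v] away from its default value. *)
Lemma Lip1_successors_bounded v x : Lip1 d v ->
  exists M : R, forall a b, `|v (T a b x)| <= M.
Proof.
move=> Lv.
suff [N _ /(_ N (leqnn N)) HN] : \forall n \near \oo,
    [set T a b x | a in [set: A] & b in [set: B]] `<=`
    (fun y => `|v y| <= n%:R).
  by exists N%:R => a b; apply: HN; exists a => //; exists b.
apply: ((compact_near_coveringP _).1 (@compact_successors x)) => y _.
have [N _ HN] := nbhs_infty_ger (`|v y| + 1).
exists (ball y 1, [set n | (N <= n)%N]).
  by split; [exact: nbhsx_ballx|exists N].
move=> [z n] /= [+ /HN /=]; rewrite ballEmdist /= => yz.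
apply: le_trans; rewrite -lerBlDl (le_trans (lerB_dist _ _))//.
by rewrite (le_trans (Lip1_mdist _ _ Lv))// metric_sym ltW.
Qed.

(** * The Shapley operator at one state, through nearly optimal actions *)

Section ShapleyValue.
Variables (v : X -> R) (Lv : Lip1 d v) (x : X).

Let best a := sup [set v (T a b x) | b in [set: B]].

Let has_sup_best a : has_sup [set v (T a b x) | b in [set: B]].
Proof.
have [b0 _] := erg_max_nonempty G; split; first by exists (v (T a b0 x)), b0.
have [M HM] := Lip1_successors_bounded x Lv.
by exists M => _ [b _ <-]; rewrite (le_trans (ler_norm _)).
Qed.

Let le_best a b : v (T a b x) <= best a.
Proof. by apply: (sup_upper_bound (has_sup_best a)); exists b. Qed.

Let has_inf_best : has_inf [set best a | a in [set: A]].
Proof.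
have [a0 _] := erg_min_nonempty G; have [b0 _] := erg_max_nonempty G.
split; first by exists (best a0), a0.
have [M HM] := Lip1_successors_bounded x Lv.
exists (- M) => _ [a _ <-]; apply: le_trans (le_best a b0).
by have := HM a b0; rewrite ler_norml => /andP[].
Qed.

Lemma shapley_le c : (exists a, forall b, v (T a b x) <= c) -> S v x <= c.
Proof.
move=> [a Ha]; apply: le_trans (_ : best a <= _).
  by apply: ge_inf; [case: has_inf_best|exists a].
by apply: ge_sup; [case: (has_sup_best a)|move=> _ [b _ <-]].
Qed.

Lemma shapley_ge c : (forall a, exists b, c <= v (T a b x)) -> c <= S v x.
Proof.
move=> H; apply: lb_le_inf; first by case: has_inf_best.
by move=> _ [a _ <-]; have [b cb] := H a; apply: le_trans cb (le_best a b).
Qed.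

Lemma shapley_lt_min c : S v x < c -> exists a, forall b, v (T a b x) < c.
Proof.
rewrite -subr_gt0 => c0; have [_ [a _ <-] ac] := inf_adherent c0 has_inf_best.
exists a => b; apply: le_lt_trans (le_best a b) _.
by move: ac; rewrite addrC subrK.
Qed.

Lemma shapley_gt_max c : c < S v x -> forall a, exists b, c < v (T a b x).
Proof.
move=> cS a; have ca : c < best a.
  by apply: lt_le_trans cS _; apply: ge_inf; [case: has_inf_best|exists a].
rewrite -subr_gt0 in ca.
have [_ [b _ <-] cb] := sup_adherent ca (has_sup_best a).
by exists b; move: cb; rewrite subKr.
Qed.

End ShapleyValue.

(** * Monotonicity and iterates of the Shapley operator *)

(** Min's [e]-optimal action for [v] at [y] is reused for [u] at [x]. Two functions and two states
    cover both monotonicity up to constants and stability of [Lip1]. *)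
Lemma shapley_comparison u v x y c : Lip1 d u -> Lip1 d v ->
  (forall a b, u (T a b x) <= v (T a b y) + c) -> S u x <= S v y + c.
Proof.
move=> Lu Lv uv; apply/ler_addgt0Pr => e e0.
have [|a Ha] := @shapley_lt_min v Lv y (S v y + e); first by rewrite ltrDl.
apply: shapley_le => //; exists a => b.
by have := uv a b; have := Ha b; lra.
Qed.

Lemma shapley_Lip1 v : Lip1 d v -> Lip1 d (S v).
Proof.
move=> Lv x y; rewrite lerBlDl; apply: shapley_comparison => // a b.
by have := Lv (T a b x) (T a b y); have := erg_nonexpansive G a b x y; lra.
Qed.

Lemma shapley_le_addr u v c : Lip1 d u -> Lip1 d v ->
  (forall x, u x <= v x + c) -> forall x, S u x <= S v x + c.
Proof. by move=> Lu Lv uv x; apply: shapley_comparison. Qed.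

Lemma iter_shapley_Lip1 v k : Lip1 d v -> Lip1 d (iter k S v).
Proof. by move=> Lv; elim: k => //= k; exact: shapley_Lip1. Qed.

Lemma iter_shapley_le_addr u v c k : Lip1 d u -> Lip1 d v ->
  (forall x, u x <= v x + c) -> forall x, iter k S u x <= iter k S v x + c.
Proof.
move=> Lu Lv uv; elim: k => //= k IH.
by apply: shapley_le_addr => //; exact: iter_shapley_Lip1.
Qed.

(** * Strategies from time-dependent potentials *)

(** At time [k] Min plays [e]-optimally for [f k.+1], so each turn raises the potential by at most
    [e]. The time is read off the length of the history. *)
Lemma min_strategy_potential (f : nat -> X -> R) (e : R) : 0 < e ->
  (forall k, Lip1 d (f k)) -> (forall k x, S (f k.+1) x <= f k x) ->
  exists sigma : min_strategy X A B,
  forall (tau : max_strategy X A B) x0 k,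
    f k (last_state (play T sigma tau x0 k)) <= f 0%N x0 + k%:R * e.
Proof.
move=> e0 Lf Sf.
have /choice[s Hs] (kx : nat * X) : exists a, forall b,
    f kx.1.+1 (T a b kx.2) < f kx.1 kx.2 + e.
  by apply: shapley_lt_min => //; have := Sf kx.1 kx.2; lra.
exists (fun h => s (size h.2, last_state h)) => tau x0.
set sg := fun h => _.
have sgE h : sg h = s (size h.2, last_state h) by [].
have sz k : size (play T sg tau x0 k).2 = k.
  by elim: k => //= k IH; rewrite size_rcons IH.
elim=> [|k IH]; first by rewrite mul0r addr0.
rewrite /= /last_state /= map_rcons last_rcons /= sgE sz.
apply: le_trans (ltW (Hs (k, _) _)) _ => /=.
by rewrite -natr1 mulrDl mul1r addrA lerD2r.
Qed.

Lemma max_strategy_potential (f : nat -> X -> R) (e : R) : 0 < e ->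
  (forall k, Lip1 d (f k)) -> (forall k x, f k x <= S (f k.+1) x) ->
  exists tau : max_strategy X A B,
  forall (sigma : min_strategy X A B) x0 k,
    f 0%N x0 - k%:R * e <= f k (last_state (play T sigma tau x0 k)).
Proof.
move=> e0 Lf Sf.
have /choice[t Ht] (kxa : nat * X * A) : exists b,
    f kxa.1.1 kxa.1.2 - e < f kxa.1.1.+1 (T kxa.2 b kxa.1.2).
  by apply: shapley_gt_max => //; have := Sf kxa.1.1 kxa.1.2; lra.
exists (fun h a => t (size h.2, last_state h, a)) => sigma x0.
set tu := fun h a => _.
have tuE h a : tu h a = t (size h.2, last_state h, a) by [].
have sz k : size (play T sigma tu x0 k).2 = k.
  by elim: k => //= k IH; rewrite size_rcons IH.
elim=> [|k IH]; first by rewrite mul0r subr0.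
rewrite /= /last_state /= map_rcons last_rcons /= tuE sz.
apply: le_trans (ltW (Ht (k, _, _))) => /=.
by rewrite -natr1 mulrDl mul1r; move: IH; lra.
Qed.

(** * Existence of a subeigenfunction for the limit rate *)

(** Normalization at [z] confines [w n x] to a compact segment of radius [mdist x z], where an
    ultrafilter converges. *)
Lemma Lip1_ultralimit (U : set_system nat) (w : nat -> X -> R) z :
  UltraFilter U -> (forall n, Lip1 d (w n)) -> (forall n, w n z = 0) ->
  exists v, Lip1 d v /\ forall x, w n x @[n --> U] --> v x.
Proof.
move=> UU Lw wz; have UP : ProperFilter U := @ultra_proper _ _ UU.
have /choice[v wv] x : exists p : R, w n x @[n --> U] --> p.
  have wb n : `|w n x| <= mdist x z.
    by rewrite -[w n x]subr0 -(wz n); exact: Lip1_mdist.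
  have [|p [_ clp]] := @segment_compact R (- mdist x z) (mdist x z)
      (w n x @[n --> U]).
    by apply: (@filterE _ U) => n /=; rewrite in_itv/= -ler_norml.
  exists p => C Cp.
  (* A cluster point of an ultrafilter is a limit: otherwise the complement of [C] would be in the
     image filter, yet miss [C]. *)
  have [//|UC] := in_ultra_setVsetC (w^~ x @^-1` C) UU.
  by have [y []] := clp (~` C) C UC Cp.
exists v; split=> // x y.
apply: (@closed_cvg _ _ U _ (fun n => w n x - w n y) [set r | r <= d x y]).
- exact: closed_le.
- by apply: filterE => n; exact: Lw.
- by apply: cvgB; exact: wv.
Qed.

(* Equi-Lipschitz functions converging pointwise converge uniformly on the
   compact set of successors of [x], so [S] passes to the limit. *)
Lemma shapley_subeigen_limit (w : nat -> X -> R) (l : nat -> R) rho z :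
  (forall n, Lip1 d (w n)) -> (forall n, w n z = 0) -> l @ \oo --> rho ->
  (forall x, \forall n \near \oo, l n + w n x <= S (w n) x) ->
  exists v, Lip1 d v /\ forall x, rho + v x <= S v x.
Proof.
move=> Lw wz lrho Sw.
have [U [UU ooU]] := @ultraFilterLemma nat \oo _.
have UP : ProperFilter U := @ultra_proper _ _ UU.
have [v [Lv wv]] := Lip1_ultralimit UU Lw wz.
exists v; split=> // x; apply/ler_addgt0Pr => e e0.
have e3 : 0 < e / 3 by rewrite divr_gt0.
have e9 : 0 < e / 9 by rewrite divr_gt0.
have near_v y c : 0 < c -> \forall n \near U, `|v y - w n y| <= c.
  by move=> c0; have /cvgrPdist_le/(_ c c0) := wv y.
have near_rho : \forall n \near U, `|rho - l n| <= e / 3.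
  by apply: ooU; have /cvgrPdist_le/(_ _ e3) := lrho.
have near_succ : \forall n \near U,
    [set T a b x | a in [set: A] & b in [set: B]] `<=`
    (fun y => w n y <= v y + e / 3).
  apply: ((compact_near_coveringP _).1 (@compact_successors x)) => y _.
  (* Three errors of [e / 9]: moving [v] and [w n] from [y] to [y'], and comparing them at [y]. *)
  exists (ball y (e / 9), [set n | `|v y - w n y| <= e / 9]).
    by split; [exact: nbhsx_ballx|exact: near_v].
  move=> [y' n] /= []; rewrite ballEmdist /= => yy'.
  rewrite ler_norml => /andP[vw _].
  have := Lip1_mdist y y' Lv; rewrite ler_norml => /andP[_ vy].
  have := Lip1_mdist y y' (Lw n); rewrite ler_norml => /andP[wy _].
  lra.
have [n [[near1 near2] [near3 near4]]] := filter_ex (filterI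
  (filterI near_succ near_rho) (filterI (near_v x _ e3) (ooU _ (Sw x)))).
have : S (w n) x <= S v x + e / 3.
  apply: shapley_comparison => // a b; apply: near1.
  by exists a => //; exists b.
move: near2 near3 near4 => /=; rewrite !ler_norml => /andP[_ h1] /andP[_ h2].
lra.
Qed.

(** Induction gives [S^i v0 <= f i + i * l]. Since [f j <= f j.+1], which is a maximum of two terms,
    [f j] lies below one of them at each point: this is the final disjunction. *)
Lemma truncated_subeigen z (l : R) j : exists f, [/\ Lip1 d f,
  iter j S (d^~ z) z <= f z + j%:R * l &
  forall x, f x <= d x z \/ l + f x <= S f x].
Proof.
pose F u x := Num.max (d x z) (S u x - l).
pose f i := iter i F (d^~ z).
have Lf i : Lip1 d (f i).
  elim: i => [|i IH]; first exact: Lip1_dist_to.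
  by apply: Lip1_max; [exact: Lip1_dist_to|exact/Lip1_addr/shapley_Lip1].
have f_ge i x : iter i S (d^~ z) x <= f i x + i%:R * l.
  elim: i x => [|i IH] x; first by rewrite mul0r addr0.
  have Lv0 : Lip1 d (iter i S (d^~ z)).
    exact/iter_shapley_Lip1/Lip1_dist_to.
  have h1 := shapley_le_addr Lv0 (Lf i) IH x.
  have h2 : S (f i) x - l <= f i.+1 x by rewrite /f /= /F le_max lexx orbT.
  by rewrite iterS -natr1 mulrDl mul1r; lra.
have f_incr i x : f i x <= f i.+1 x.
  elim: i x => [|i IH] x; first by rewrite /f /= /F le_max lexx.
  have : S (f i) x <= S (f i.+1) x + 0.
    by apply: shapley_le_addr => // y; rewrite addr0.
  rewrite addr0 => SS; rewrite [leLHS]/(F _ _) [leRHS]/(F _ _) /F.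
  by rewrite ge_max !le_max lexx lerD2r SS orbT.
exists (f j); split=> // x; have := f_incr j x.
have -> : f j.+1 x = Num.max (d x z) (S (f j) x - l) by [].
by rewrite le_max lerBrDl => /orP.
Qed.

Lemma subeigen_exists z rho :
  (forall k, k%:R * rho <= iter k S (d^~ z) z) ->
  exists v, Lip1 d v /\ forall x, rho + v x <= S v x.
Proof.
(* With [j = n * n.+1] iterations, [j * (rho - l n) = n], which forces [n <= f n z]. *)
move=> rhos; pose l n : R := rho - n.+1%:R^-1.
have /choice[f Hf] n := truncated_subeigen z (l n) (n * n.+1)%N.
have Lf n : Lip1 d (f n) by case: (Hf n).
have fz n : n%:R <= f n z.
  have [_ + _] := Hf n; move: (rhos (n * n.+1)%N).
  have : (n * n.+1)%:R * l n = (n * n.+1)%:R * rho - n%:R.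
    by rewrite mulrBr natrM mulfK.
  lra.
apply: (@shapley_subeigen_limit (fun n x => f n x - f n z) l _ z).
- by move=> n; exact: Lip1_addr.
- by move=> n; rewrite subrr.
- rewrite -[rho in _ --> rho]subr0; apply: cvgB; first exact: cvg_cst.
  exact: cvg_harmonic.
(* For such [n], [f n x >= f n z - d z x > d x z]: the truncation is inactive at [x]. *)
move=> x; have [N _ HN] := nbhs_infty_ger (d x z + d z x + 1).
exists N => // n /HN /= nN; have [_ _ /(_ x)[fx|Sf]] := Hf n.
  by have := Lf n z x; have := fz n; lra.
have : S (f n) x <= S (fun y => f n y - f n z) x + f n z.
  apply: shapley_comparison => //; first exact: Lip1_addr.
  by move=> a b; rewrite subrK.
lra.
Qed.

(** * Growth of the iterates of the distance function *)

Lemma subeigen_iter z lambda v k : Lip1 d v ->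
  (forall x, lambda + v x <= S v x) -> k%:R * lambda <= iter k S (d^~ z) z.
Proof.
move=> Lv Sv.
have vk x : v x <= iter k S v x + - (k%:R * lambda).
  elim: k x => [|k IH] x; first by rewrite mul0r subr0.
  have Lk := iter_shapley_Lip1 k Lv.
  have := shapley_le_addr Lv Lk IH x; have := Sv x.
  by rewrite iterS -natr1 mulrDl mul1r; lra.
have Lz := @Lip1_dist_to z.
have v_le x : v x <= d x z + v z by have := Lv x z; lra.
by have := iter_shapley_le_addr k Lv Lz v_le z; have := vk z; lra.
Qed.

Lemma iter_shapley_dist_le z k x :
  iter k S (d^~ z) x <= d x z + iter k S (d^~ z) z.
Proof.
have := iter_shapley_Lip1 k (@Lip1_dist_to z).
by move=> /(_ x z); lra.
Qed.

Lemma iter_shapley_dist_subadd z m n :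
  iter (m + n) S (d^~ z) z <= iter m S (d^~ z) z + iter n S (d^~ z) z.
Proof.
rewrite iterD; have Lz := @Lip1_dist_to z.
have Ln := iter_shapley_Lip1 n Lz.
exact: (iter_shapley_le_addr m Ln Lz (iter_shapley_dist_le z n) z).
Qed.

(** This is the linear lower bound for Fekete's lemma. By nonexpansiveness, [d z _] grows by at most
    [M] per turn whatever the actions, and [- d z x <= d x z]. *)
Lemma iter_shapley_dist_ge z :
  exists M : R, forall k, - (k%:R * M) <= iter k S (d^~ z) z.
Proof.
have [M HM] := Lip1_successors_bounded z (@Lip1_opp_dist_from z).
have [b0 _] := erg_max_nonempty G.
suff iter_ge k x : - d z x - k%:R * M <= iter k S (d^~ z) x.
  by exists M => k; have := iter_ge k z; rewrite dxx oppr0 add0r.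
elim: k x => [|k IH] x.
  by rewrite mul0r subr0 /=; have := dtri z x z; rewrite dxx; lra.
apply: shapley_ge; first exact/iter_shapley_Lip1/Lip1_dist_to.
move=> a; exists b0; apply: le_trans (IH _).
have := HM a b0; rewrite normrN ler_norml => /andP[_ h1].
have := dtri z (T a b0 z) (T a b0 x); have := erg_nonexpansive G a b0 z x.
by rewrite -natr1 mulrDl mul1r; lra.
Qed.

(** * Min's block strategy *)

(** By nonexpansiveness a turn adds at most [d (T a b z) z]. This controls the turns after the last
    block end. *)
Lemma play_dist_growth z : exists2 M : R, 0 <= M &
  forall sigma tau m i,
    d (last_state (play T sigma tau z (m + i))) z <=
    d (last_state (play T sigma tau z m)) z + i%:R * M.
Proof.
have [M HM] := Lip1_successors_bounded z (@Lip1_dist_to z).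
have [a0 _] := erg_min_nonempty G; have [b0 _] := erg_max_nonempty G.
exists M => [|sigma tau m]; first exact: le_trans (normr_ge0 _) (HM a0 b0).
elim=> [|i IH]; first by rewrite addn0 mul0r addr0.
rewrite addnS /=; set h := play _ _ _ _ (m + i)%N in IH *.
rewrite {1}/last_state /= map_rcons last_rcons /=.
set a := sigma h; set b := tau h a.
have := HM a b; rewrite ler_norml => /andP[_ h1].
have := dtri (T a b (last_state h)) (T a b z) z.
have := erg_nonexpansive G a b (last_state h) z.
by rewrite -natr1 mulrDl mul1r; lra.
Qed.

(* The potential used by Min is a countdown: with [r = k %% p], it tells Min
   to play optimally for the terminal payoff [d _ z] at the end of a block of
   length [p], whose ends are the times [k] with [r = p - 1]. *)
Lemma min_guarantee z p (l e : R) : (0 < p)%N -> 0 < e ->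
  iter p S (d^~ z) z <= p%:R * l ->
  exists (sigma : min_strategy X A B) (N : nat),
  forall k, (N <= k)%N -> forall tau : max_strategy X A B,
    payoff d T z sigma tau k <= k%:R * (l + e).
Proof.
case: p => // p _ e0 spl; set sp := iter p.+1 S (d^~ z) z in spl.
have e2 : 0 < e / 2 by rewrite divr_gt0.
(* The block length is now [p.+1], and [sp] is charged each time a new block starts. *)
pose f k x := iter (p - k %% p.+1) S (d^~ z) x + - ((k %/ p.+1)%:R * sp).
have Lf k : Lip1 d (f k) by exact/Lip1_addr/iter_shapley_Lip1/Lip1_dist_to.
have Sf k x : S (f k.+1) x <= f k x.
  have Li n := iter_shapley_Lip1 n (@Lip1_dist_to z).
  have Sadd n c : S (fun y => iter n S (d^~ z) y + c) x <=
      iter n.+1 S (d^~ z) x + c.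
    by apply: shapley_le_addr; [exact: Lip1_addr|exact: Li|].
  rewrite /f; have := ltn_pmod k (ltn0Sn p); rewrite ltnS leq_eqVlt.
  (* At a block end the countdown restarts, and [S^p.+1 v0 <= v0 + sp] pays the charge; elsewhere
     [S] just undoes one step of the countdown. *)
  case/orP => [/eqP kp|kp].
    have -> : k.+1 = ((k %/ p.+1).+1 * p.+1)%N.
      by rewrite {1}(divn_eq k p.+1) kp -addnS mulSn addnC.
    rewrite modnMl mulnK// kp subnn subn0 (le_trans (Sadd _ _))//.
    have := iter_shapley_dist_le z p.+1 x; rewrite -/sp.
    by rewrite -natr1 mulrDl mul1r [iter 0 _ _ _]/=; lra.
  have kS : k.+1 = (k %/ p.+1 * p.+1 + (k %% p.+1).+1)%N.
    by rewrite addnS -divn_eq.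
  rewrite {1 2}kS modnMDl divnMDl//.
  rewrite (@divn_small (k %% p.+1).+1)// (@modn_small (k %% p.+1).+1)// addn0.
  by rewrite (le_trans (Sadd _ _))// subnSK.
have [sigma Hsigma] := min_strategy_potential e2 Lf Sf.
have [M M0 HM] := play_dist_growth z.
pose K : R := `|f 0%N z| + p.+1%:R * M + `|sp|.
have [N HN] := divn_growth_le K (ltn0Sn p) spl e2.
exists sigma, (maxn N p.+1) => k; rewrite geq_max => /andP[/HN Nk pk] tau.
have q0 : (0 < k %/ p.+1)%N by rewrite divn_gt0.
pose q := (k %/ p.+1).-1; have qE : (k %/ p.+1)%N = q.+1 by rewrite prednK.
(* [m] is the last block end strictly before [k]; there the potential is the distance to [z] minus
   [q * sp]. The term [|sp|] in [K] makes up for [q] being one less than [k %/ p.+1]. *)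
pose m := (q * p.+1 + p)%N.
have mf : f m = fun x => d x z + - (q%:R * sp).
  apply/funext => x.
  by rewrite /f modnMDl divnMDl// modn_small// divn_small// subnn addn0.
have kE : k = (m + (k %% p.+1).+1)%N.
  by rewrite {1}(divn_eq k p.+1) qE mulSn /m addnS -addSn -addnS
    [X in (X + _)%N]addnC.
have := HM sigma tau m (k %% p.+1).+1; rewrite -kE => dk.
have := Hsigma tau z m; rewrite mf => dm.
have rM : (k %% p.+1).+1%:R * M <= p.+1%:R * M.
  by rewrite ler_wpM2r// ler_nat ltn_pmod.
have me : m%:R * (e / 2) <= k%:R * (e / 2).
  by rewrite ler_wpM2r ?(ltW e2)// ler_nat kE leq_addr.
have f0 := ler_norm (f 0%N z).
have nsp : - sp <= `|sp| by rewrite -normrN ler_norm.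
have kle : k%:R * (l + e) = k%:R * (l + e / 2) + k%:R * (e / 2).
  by rewrite -mulrDr -addrA -splitr.
move: Nk; rewrite /payoff kle /K qE -natr1 mulrDl mul1r => Nk.
lra.
Qed.

End EscapeRateGame.

(** * Uniform value and the two maxima *)

Theorem theorem4 (R : realType) (X : metricType R) (A B : topologicalType)
    (d : X -> X -> R) (T : A -> B -> X -> X) (G : escape_rate_game d T) :
  exists rho : R,
    (forall x0 : X, has_uniform_value d T x0 rho) /\
    (forall xbar : X,
       (fun k : nat =>
          iter k (shapley T) (fun x => d x xbar) xbar / k%:R) @ \oo --> rho) /\
    is_maximum
      [set lambda : R | exists v : X -> R,
         Lip1 d v /\ forall x, lambda + v x <= shapley T v x] rho /\
    is_maximum
      [set ereal_inf [set (shapley T v x - v x)%:E | x in [set: X]]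
         | v in Lip1 d] rho%:E.
Proof.
have [z _] := erg_state_nonempty G.
have growth y : exists r : R,
    (iter k (shapley T) (d^~ y) y / k%:R @[k --> \oo] --> r) /\
    forall k, k%:R * r <= iter k (shapley T) (d^~ y) y.
  have [M HM] := iter_shapley_dist_ge G y.
  exact: (fekete (iter_shapley_dist_subadd G y) HM).
have growth_ge y (r l : R) v :
    iter k (shapley T) (d^~ y) y / k%:R @[k --> \oo] --> r ->
    Lip1 d v -> (forall x, l + v x <= shapley T v x) -> l <= r.
  move=> cvr Lv Sv; apply: (@closed_cvg _ _ \oo _ _ [set t | l <= t] _ _ _ cvr).
    exact: closed_ge.
  exists 1%N => // k /= k0; rewrite ler_pdivlMr ?ltr0n// mulrC.
  exact: (subeigen_iter G _ _ Lv Sv).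
have [rho [cvrho rho_le]] := growth z.
have [v [Lv Sv]] := subeigen_exists G rho_le.
(* The limits at [y] and [z] both admit subeigenfunctions, so each bounds the other. *)
have cv y : iter k (shapley T) (d^~ y) y / k%:R @[k --> \oo] --> rho.
  have [r [cvr r_le]] := growth y; have [u [Lu Su]] := subeigen_exists G r_le.
  suff -> : rho = r by [].
  apply/eqP; rewrite eq_le (growth_ge y r _ v)//=.
  exact: growth_ge cvrho Lu Su.
exists rho; split; last split=> //; last split.
- move=> x0 e e0; have e2 : 0 < e / 2 by rewrite divr_gt0.
  have [p p0 sp] : exists2 p, (0 < p)%N &
      iter p (shapley T) (d^~ x0) x0 <= p%:R * (rho + e / 2).
    have [N _ HN] := (cvgrPdist_le _ _).1 (cv x0) _ e2.
    exists N.+1 => //; have /= := HN N.+1 (leqnSn N).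
    rewrite ler_norml lerNl opprB lerBlDl => /andP[+ _].
    by rewrite ler_pdivrMr// mulrC.
  have [sigma [N HN]] := min_guarantee G p0 e2 sp.
  pose f k x := v x + - (k%:R * rho).
  have Lf k : Lip1 d (f k) by exact: Lip1_addr.
  have Sf k x : f k x <= shapley T (f k.+1) x.
    have : shapley T v x <= shapley T (f k.+1) x + k.+1%:R * rho.
      by apply: (shapley_le_addr G) => // y; rewrite /f subrK.
    by rewrite /f -natr1 mulrDl mul1r; have := Sv x; lra.
  have [tau Htau] := max_strategy_potential G e0 Lf Sf.
  exists sigma, tau, (maxn N 1) => k; rewrite geq_max => /andP[/HN kN k0] s t.
  have kp : 0 < k%:R :> R by rewrite ltr0n.
  rewrite ler_pdivrMr// ler_pdivlMr//; split.
    by rewrite (le_trans (kN _))// mulrC -addrA -splitr.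
  (* [v x_k - v x0 <= d x_k x0] turns the potential bound into a payoff bound. *)
  have := Htau s x0 k; rewrite /f /payoff mul0r subr0.
  have := Lv (last_state (play T s tau x0 k)) x0; lra.
- by split=> [|l [u [Lu Su]]]; [exists v|exact: growth_ge cvrho Lu Su].
have inf_le u : Lip1 d u ->
    (ereal_inf [set (shapley T u x - u x)%:E | x in [set: X]] <= rho%:E)%E.
  move=> Lu; set m := ereal_inf _.
  have mle x : (m <= (shapley T u x - u x)%:E)%E.
    by apply: ereal_inf_lbound; exists x.
  (* A finite infimum is itself a feasible rate for [u]; the state [z] excludes [+oo]. *)
  move: mle; case: m => [r| |] mle; last by rewrite leNye.
    rewrite lee_fin; apply: growth_ge cvrho Lu _ => x.
    by have := mle x; rewrite lee_fin lerBrDr.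
  by have := mle z; rewrite leye_eq.
split; last by move=> _ [u Lu <-]; exact: inf_le.
exists v => //; apply/eqP; rewrite eq_le inf_le//=.
apply/ereal_infP => _ [x _ <-]; rewrite lee_fin lerBrDr; exact: Sv.
Qed.
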